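(* Let $A,B\in\mathbb{C}^{m\times n}$. Then: (a) $A\,{*\!\leq}\,B$ if and only if $A^{-\dagger}A=A^{-\dagger}B$ and $AA^{-\dagger}=BA^{-\dagger}$ for some $A^{-\dagger}\in\mathcal{A}\{-\dagger\}$. (b) $A\,{\leq\!*}\,B$ if and only if $A^{\dagger-}A=A^{\dagger-}B$ and $AA^{\dagger-}=BA^{\dagger-}$ for some $A^{\dagger-}\in\mathcal{A}\{\dagger-\}$.
   Context: $A^*$ is the conjugate transpose, $\mathcal{R}(\cdot)$ the range (column space), and $A^\dagger\in\mathbb{C}^{n\times m}$ the Moore-Penrose inverse of $A\in\mathbb{C}^{m\times n}$. The set of inner inverses of $A$ is $\mathcal{A}\{1\}=\{X\in\mathbb{C}^{n\times m}: AXA=A\}$. The sets of 1MP-inverses and MP1-inverses of $A$ are $\mathcal{A}\{-\dagger\}=\{A^-AA^\dagger: A^-\in\mathcal{A}\{1\}\}$ and $\mathcal{A}\{\dagger-\}=\{A^\dagger AA^-: A^-\in\mathcal{A}\{1\}\}$; their elements are denoted $A^{-\dagger}$ and $A^{\dagger-}$, respectively. Left star order: $A\,{*\!\leq}\,B$ iff $A^*A=A^*B$ and $\mathcal{R}(A)\subseteq\mathcal{R}(B)$. Right star order: $A\,{\leq\!*}\,B$ iff $AA^*=BA^*$ and $\mathcal{R}(A^* )\subseteq\mathcal{R}(B^* )$. *)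

(* Defs.v *)
From mathcomp Require Import all_boot all_order all_algebra.
From mathcomp Require Export sesquilinear spectral.
From mathcomp Require Export complex.
From mathcomp Require Export boolp classical_sets reals.

Set Implicit Arguments.
Unset Strict Implicit.
Unset Printing Implicit Defensive.
Import Order.TTheory GRing.Theory Num.Theory.

Local Open Scope ring_scope.
Local Open Scope sesquilinear_scope.
Local Open Scope classical_set_scope.

Section MoorePenrose.
Variable C : numClosedFieldType.

(* Penrose's four equations; [M ^t*] is MathComp's conjugate transpose. *)
Definition is_MP_inverse m n (A : 'M[C]_(m, n)) (X : 'M[C]_(n, m)) : bool :=
  [&& A *m X *m A == A, X *m A *m X == X,
      (A *m X) ^t* == A *m X & (X *m A) ^t* == X *m A].

Lemma is_MP_inverseP m n (A : 'M[C]_(m, n)) (X : 'M[C]_(n, m)) :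
  reflect [/\ A *m X *m A = A, X *m A *m X = X,
              (A *m X) ^t* = A *m X & (X *m A) ^t* = X *m A]
          (is_MP_inverse A X).
Proof.
by apply: (iffP and4P) => -[h1 h2 h3 h4]; split; apply/eqP.
Qed.

(* The next lemmas lead to existence and uniqueness of the Moore-Penrose
   inverse, so that [MP_inverse] below is total and canonical. *)
Lemma trmxC_mul m n p (A : 'M[C]_(m, n)) (B : 'M[C]_(n, p)) :
  (A *m B) ^t* = B ^t* *m A ^t*.
Proof. by rewrite trmx_mul map_mxM. Qed.

Lemma mulmx_trmxC_eq0 m n (A : 'M[C]_(m, n)) : A *m A ^t* = 0 -> A = 0.
Proof.
move=> /matrixP A0; apply/matrixP => i j; have := A0 i i; rewrite !mxE => /eqP.
rewrite psumr_eq0 => [/allP/(_ j)|k _]; last by rewrite !mxE mul_conjC_ge0.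
by rewrite mem_index_enum !mxE mul_conjC_eq0 => /(_ isT)/eqP.
Qed.

Lemma row_free_gram_unit r n (G : 'M[C]_(r, n)) :
  row_free G -> G *m G ^t* \in unitmx.
Proof.
move=> Gfree; rewrite -row_free_unit -kermx_eq0.
set K := kermx _; have KG : K *m G = 0.
  apply: mulmx_trmxC_eq0; rewrite trmxC_mul.
  by rewrite mulmxA -(mulmxA K) mulmx_ker mul0mx.
by apply/eqP; apply: (row_free_inj Gfree); rewrite KG mul0mx.
Qed.

Lemma trmxC_inv n (A : 'M[C]_n) : (invmx A) ^t* = invmx (A ^t*).
Proof. by rewrite trmx_inv map_invmx. Qed.

Lemma MP_inverse_exists m n (A : 'M[C]_(m, n)) :
  exists X : 'M[C]_(n, m), is_MP_inverse A X.
Proof.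
pose F := col_base A; pose G := row_base A.
have AE : F *m G = A by exact: mulmx_base.
have uG : G *m G ^t* \in unitmx by apply/row_free_gram_unit/row_base_free.
have uF : F ^t* *m F \in unitmx.
  rewrite -{2}(trmxCK F); apply: row_free_gram_unit.
  by rewrite /row_free mxrank_map mxrank_tr; apply: col_base_full.
clearbody F G.
pose Gi := G ^t* *m invmx (G *m G ^t*).
pose Fi := invmx (F ^t* *m F) *m F ^t*.
have GGi : G *m Gi = 1%:M by rewrite mulmxA mulmxV.
have FiF : Fi *m F = 1%:M by rewrite -mulmxA mulVmx.
have AX : F *m G *m (Gi *m Fi) = F *m Fi.
  by rewrite mulmxA -(mulmxA F) GGi mulmx1.
have XA : Gi *m Fi *m (F *m G) = Gi *m G.
  by rewrite mulmxA -(mulmxA Gi) FiF mulmx1.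
exists (Gi *m Fi).
suff: is_MP_inverse (F *m G) (Gi *m Fi) by rewrite AE.
apply/is_MP_inverseP; split.
- by rewrite AX mulmxA -(mulmxA F) FiF mulmx1.
- by rewrite XA mulmxA -(mulmxA Gi G) GGi mulmx1.
- by rewrite AX /Fi !(trmxC_mul, trmxC_inv, trmxCK) mulmxA.
- by rewrite XA /Gi !(trmxC_mul, trmxC_inv, trmxCK) mulmxA.
Qed.

Lemma MP_inverse_unique m n (A : 'M[C]_(m, n)) (X Y : 'M[C]_(n, m)) :
  is_MP_inverse A X -> is_MP_inverse A Y -> X = Y.
Proof.
move=> /is_MP_inverseP[X1 X2 X3 X4] /is_MP_inverseP[Y1 Y2 Y3 Y4].
have AXY : A *m X = A *m Y.
  by rewrite -X3 -{1}Y1 -(mulmxA (A *m Y)) trmxC_mul X3 Y3 mulmxA X1.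
have XYA : X *m A = Y *m A.
  by rewrite -X4 -{1}Y1 -mulmxA mulmxA trmxC_mul X4 Y4 -mulmxA (mulmxA A) X1.
by rewrite -X2 XYA -mulmxA AXY mulmxA Y2.
Qed.

Definition MP_inverse m n (A : 'M[C]_(m, n)) : 'M[C]_(n, m) :=
  xchoose (MP_inverse_exists A).

Lemma MP_inverseP m n (A : 'M[C]_(m, n)) : is_MP_inverse A (MP_inverse A).
Proof. exact: xchooseP. Qed.

End MoorePenrose.

Notation "A ^†" := (MP_inverse A) (at level 8, format "A ^†") : ring_scope.

Section StarOrders.
Variables (C : numClosedFieldType) (m n : nat).
Implicit Types A B : 'M[C]_(m, n).

Definition inner_inverses A : set 'M[C]_(n, m) :=
  [set X | A *m X *m A = A].

Definition inverses_1MP A : set 'M[C]_(n, m) :=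
  [set G *m A *m A^† | G in inner_inverses A].

Definition inverses_MP1 A : set 'M[C]_(n, m) :=
  [set A^† *m A *m G | G in inner_inverses A].

End StarOrders.

(* MathComp's [(_ <= _)%MS] compares row spaces; the range here is the column
   space, as a set of column vectors. *)
Definition colspace (C : numClosedFieldType) m n (A : 'M[C]_(m, n)) :
    set 'cV[C]_m :=
  range (fun x : 'cV[C]_n => A *m x).

Definition left_star_le (C : numClosedFieldType) m n (A B : 'M[C]_(m, n)) :
    Prop :=
  A ^t* *m A = A ^t* *m B /\ colspace A `<=` colspace B.

Definition right_star_le (C : numClosedFieldType) m n (A B : 'M[C]_(m, n)) :
    Prop :=
  A *m A ^t* = B *m A ^t* /\ colspace (A ^t*) `<=` colspace (B ^t*).

(* Main.v *)
Require Import Defs.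
From mathcomp Require Import all_boot all_order all_algebra.

Local Open Scope ring_scope.

(** Both directions rest on reformulating the star orders by products:
    [A^* A = A^* B] means [A A^† B = A], and the range inclusion means
    [B W A = A] for any inner inverse [W] of [B].  Given these, [B^†] is itself
    an inner inverse of [A], since [A B^† A = A A^† B B^† A = A A^† A = A], and
    [B^† A A^†] is the required 1MP-inverse.  Part (b) is the mirror image. *)

Section StarOrderFactorization.
Set Implicit Arguments.
Unset Strict Implicit.
Local Open Scope sesquilinear_scope.
Local Open Scope classical_set_scope.
Variable C : numClosedFieldType.

(** [B *m W] is idempotent and acts as the identity exactly on the column space of [B]; the
    inclusion is tested on the columns of [A]. *)
Lemma colspace_subP m n p (A : 'M[C]_(m, p)) (B : 'M[C]_(m, n))
    (W : 'M[C]_(n, m)) :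
  B *m W *m B = B -> colspace A `<=` colspace B <-> B *m W *m A = A.
Proof.
move=> BWB; split=> [sAB | BWA].
  apply/matrixP => i j; suff /matrixP/(_ i 0) : col j (B *m W *m A) = col j A.
    by rewrite !mxE.
  rewrite !colE -mulmxA.
  have [y _ <-] : colspace B (A *m delta_mx j 0).
    by apply: sAB; exists (delta_mx j 0).
  by rewrite mulmxA BWB.
by move=> _ [x _ <-]; exists (W *m A *m x); rewrite // !mulmxA BWA.
Qed.

(** [A ^t*] and [A *m A^†] are left multiples of each other ([E] and [F]), so either left factor can
    replace the other in an equation. *)
Lemma mulmx_trmxC_MP m n p (A : 'M[C]_(m, n)) (B : 'M[C]_(m, p))
    (D : 'M[C]_(m, p)) :
  A ^t* *m B = A ^t* *m D <-> A *m A^† *m B = A *m A^† *m D.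
Proof.
have /is_MP_inverseP[MP1 _ MP3 _] := MP_inverseP A.
have E : A *m A^† = (A^†) ^t* *m A ^t* by rewrite -trmxC_mul MP3.
have F : A ^t* = A ^t* *m (A *m A^†) by rewrite -MP3 -trmxC_mul MP1.
by split=> H; [rewrite E -!mulmxA H | rewrite F -!(mulmxA (A ^t*)) H].
Qed.

Lemma mulmx_MP_trmxC m n p (A : 'M[C]_(m, n)) (B D : 'M[C]_(p, n)) :
  B *m A ^t* = D *m A ^t* <-> B *m (A^† *m A) = D *m (A^† *m A).
Proof.
have /is_MP_inverseP[MP1 _ _ MP4] := MP_inverseP A.
have E : A^† *m A = A ^t* *m (A^†) ^t* by rewrite -trmxC_mul MP4.
have F : A ^t* = A^† *m A *m A ^t* by rewrite -MP4 -trmxC_mul mulmxA MP1.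
by split=> H; [rewrite E !mulmxA H | rewrite F !(mulmxA _ _ (A ^t*)) H].
Qed.

Lemma left_star_leP m n (A B : 'M[C]_(m, n)) :
  left_star_le A B <-> A *m A^† *m B = A /\ B *m B^† *m A = A.
Proof.
have /is_MP_inverseP[A1 _ _ _] := MP_inverseP A.
have /is_MP_inverseP[B1 _ _ _] := MP_inverseP B.
rewrite /left_star_le (colspace_subP _ B1) mulmx_trmxC_MP A1.
by split=> -[].
Qed.

Lemma right_star_leP m n (A B : 'M[C]_(m, n)) :
  right_star_le A B <-> B *m A^† *m A = A /\ A *m B^† *m B = A.
Proof.
have /is_MP_inverseP[A1 _ _ _] := MP_inverseP A.
have /is_MP_inverseP[B1 _ _ _] := MP_inverseP B.
(* The adjoint of [B^†] is an inner inverse of [B ^t*], as [colspace_subP] requires. *)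
have B1t : B ^t* *m (B^†) ^t* *m B ^t* = B ^t*.
  by rewrite -!trmxC_mul mulmxA B1.
rewrite /right_star_le (colspace_subP _ B1t) mulmx_MP_trmxC !mulmxA A1.
rewrite -!trmxC_mul !mulmxA; split=> -[BAA H]; split=> //.
  (* The range condition [H] is the adjoint of [A *m B^† *m B = A]. *)
  by rewrite -[RHS]trmxCK -H trmxCK.
by rewrite H.
Qed.

Lemma left_star_le_1MP m n (A B : 'M[C]_(m, n)) :
  left_star_le A B <->
  exists X, [/\ inverses_1MP A X, X *m A = X *m B & A *m X = B *m X].
Proof.
have /is_MP_inverseP[A1 _ _ _] := MP_inverseP A.
have /is_MP_inverseP[B1 _ _ _] := MP_inverseP B.
rewrite left_star_leP; split=> [[AAB BBA] | [_ [[G AGA <-] XAB AXB]]].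
  have ABA : A *m B^† *m A = A.
    by rewrite -{1}AAB -2!(mulmxA (A *m A^†)) BBA A1.
  exists (B^† *m A *m A^†); split; first by exists B^†.
    by rewrite -!(mulmxA B^†) AAB A1.
  by rewrite !mulmxA ABA BBA.
split.
  (* Left multiplication by [A] absorbs [G], since [A *m G *m A = A]. *)
  by move/(congr1 (mulmx A)): XAB; rewrite !mulmxA AGA A1.
(* Right multiplication by [A] removes [A^†] and yields [A = B *m G *m A], a factorization through
   [B] that [B *m B^†] fixes. *)
move/(congr1 (mulmx^~ A)): AXB.
rewrite /= !mulmxA AGA A1 -(mulmxA _ A^†) -(mulmxA _ A) (mulmxA A) A1 => ABGA.
by rewrite {1}ABGA !mulmxA B1 -ABGA.
Qed.

Lemma right_star_le_MP1 m n (A B : 'M[C]_(m, n)) :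
  right_star_le A B <->
  exists X, [/\ inverses_MP1 A X, X *m A = X *m B & A *m X = B *m X].
Proof.
have /is_MP_inverseP[A1 _ _ _] := MP_inverseP A.
have /is_MP_inverseP[B1 _ _ _] := MP_inverseP B.
rewrite right_star_leP; split=> [[BAA ABB] | [_ [[G AGA <-] XAB AXB]]].
  have ABA : A *m B^† *m A = A by rewrite -{2}BAA !mulmxA ABB A1.
  exists (A^† *m A *m B^†); split; first by exists B^†.
    by rewrite -!(mulmxA A^†) ABA ABB.
  by rewrite !mulmxA A1 BAA.
split.
  move/(congr1 (mulmx^~ A)): AXB; rewrite /= !mulmxA A1 AGA.
  by rewrite -(mulmxA _ A G) -(mulmxA _ (A *m G)) AGA.
(* Dually, [A = A *m G *m B] factors through [B] on the right, so [B^† *m B] fixes it. *)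
move/(congr1 (mulmx A)): XAB; rewrite !mulmxA A1 AGA => AGB.
by rewrite AGB -!mulmxA (mulmxA B) B1.
Qed.

End StarOrderFactorization.

Theorem theorem3p2 (R : realType) (m n : nat) (A B : 'M[R[i]]_(m, n)) :
  (left_star_le A B <->
     exists X : 'M[R[i]]_(n, m),
       [/\ inverses_1MP A X, X *m A = X *m B & A *m X = B *m X]) /\
  (right_star_le A B <->
     exists X : 'M[R[i]]_(n, m),
       [/\ inverses_MP1 A X, X *m A = X *m B & A *m X = B *m X]).
Proof. by split; [exact: left_star_le_1MP | exact: right_star_le_MP1]. Qed.
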